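(* Let $\sigma\subseteq\overline M_{\mathbb R}$ be a reflexive Gorenstein cone of index $r$ in a lattice $\overline M$ of rank $d+1$, let $\tilde\Delta$ be its support and $\tilde\nabla=\sigma^\vee\cap\{\langle m_{\sigma^\vee},y\rangle=1\}$ the support of $\sigma^\vee$ (a $d$-dimensional Gorenstein polytope of index $r$). Suppose $\tilde\nabla$ contains a special $(r-1)$-simplex with vertices $n_1,\dots,n_r$, and let $\tilde\Delta_i:=\{x\in\tilde\Delta:\langle x,n_j\rangle=0\ \forall j\ne i\}$, so that $\tilde\Delta=\mathrm{Conv}(\tilde\Delta_1,\dots,\tilde\Delta_r)$ is a Cayley polytope. Put $x:=n_\sigma/r=(n_1+\cdots+n_r)/r$, $N':=\overline N+\mathbb Z x$, $L:=\mathrm{lin}(n_1,\dots,n_r)$, and let $\pi:\overline N_{\mathbb R}\to\overline N_{\mathbb R}/L$ be the quotient map, with lattice $\pi(N')$. Then $P:=\pi(\tilde\nabla)$ is a $(d-r+1)$-dimensional reflexive polytope with respect to $\pi(N')$, its $h^*$-polynomial satisfies $h^*_P(t)=h^*_{\tilde\nabla}(t)$, and, identifying the dual space of $\overline N_{\mathbb R}/L$ with $L^\perp\subseteq\overline M_{\mathbb R}$, its dual reflexive polytope is $P^*=\tilde\Delta_1+\cdots+\tilde\Delta_r-m_{\sigma^\vee}$ (a translate of the Minkowski sum of the Cayley factors).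
   Context: $\overline M,\overline N$ dual lattices with pairing $\langle\cdot,\cdot\rangle$. A full-dimensional rational polyhedral cone $\sigma$ is Gorenstein if generated by lattice points in $\{\langle x,n\rangle=1\}$ for some lattice $n$, unique, denoted $n_\sigma$; support $=\sigma\cap\{\langle x,n_\sigma\rangle=1\}$; $\sigma^\vee$ is the dual cone; $\sigma$ is reflexive Gorenstein if $\sigma^\vee$ is Gorenstein too, with corresponding point $m_{\sigma^\vee}$; index $r=\langle m_{\sigma^\vee},n_\sigma\rangle$. A lattice polytope $Q$ with $0$ in its interior is reflexive if $Q^*=\{y:\langle x,y\rangle\ge-1\ \forall x\in Q\}$ is a lattice polytope. A special $(r-1)$-simplex of a lattice polytope $\nabla$ is the convex hull of $r$ affinely independent lattice points of $\nabla$ such that every facet of $\nabla$ contains exactly $r-1$ of them. For a lattice polytope $Q$ of dimension $k$ (with respect to a given (affine) lattice), the $h^*$-polynomial is $h^*_Q(t)=(1-t)^{k+1}\sum_{j\ge0}\#(jQ\cap\text{lattice})\,t^j$ (with $0Q$ counted as one point). *)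

(* Defs.v *)
From HB Require Import structures.
From mathcomp Require Import all_boot all_order all_algebra finmap.
From mathcomp Require Import boolp classical_sets cardinality reals.
Set Implicit Arguments. Unset Strict Implicit. Unset Printing Implicit Defensive.
Import Order.TTheory GRing.Theory Num.Theory.
Local Open Scope ring_scope.
Local Open Scope classical_set_scope.

(* Both M_R and N_R are modelled as 'rV[R]_n (with lattices Z^n),
   the pairing being the standard dot product. *)
Section Defs.
Variable R : realType.

Definition pair {n} (x y : 'rV[R]_n) : R := \sum_(i < n) x ord0 i * y ord0 i.

Definition isZvec {n} (x : 'rV[R]_n) : Prop := forall i, x ord0 i \is a Num.int.

Definition cone_of {n} (S : seq 'rV[R]_n) : set 'rV[R]_n :=
  [set x | exists c : 'I_(size S) -> R,
     (forall i, 0 <= c i) /\ x = \sum_(i < size S) c i *: S`_i].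

Definition conv {n} (S : seq 'rV[R]_n) : set 'rV[R]_n :=
  [set x | exists c : 'I_(size S) -> R,
     (forall i, 0 <= c i) /\ \sum_(i < size S) c i = 1 /\
     x = \sum_(i < size S) c i *: S`_i].

(* full-dimensional: the linear span (= sigma - sigma for a convex cone) is everything *)
Definition fulldim {n} (s : set 'rV[R]_n) : Prop :=
  forall y, exists a b, s a /\ s b /\ y = a - b.

Definition gorenstein {n} (s : set 'rV[R]_n) (n0 : 'rV[R]_n) : Prop :=
  fulldim s /\ isZvec n0 /\
  exists S : seq 'rV[R]_n,
    (forall v, v \in S -> isZvec v /\ pair v n0 = 1) /\ s = cone_of S.

Definition dual_cone {n} (s : set 'rV[R]_n) : set 'rV[R]_n :=
  [set y | forall x, s x -> 0 <= pair x y].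

Definition cone_support {n} (s : set 'rV[R]_n) (n0 : 'rV[R]_n) : set 'rV[R]_n :=
  [set x | s x /\ pair x n0 = 1].

Definition affindep {n k} (p : 'I_k -> 'rV[R]_n) : Prop :=
  forall c : 'I_k -> R, \sum_(i < k) c i = 0 ->
    \sum_(i < k) c i *: p i = 0 -> forall i, c i = 0.

Definition affdim {n} (A : set 'rV[R]_n) (k : nat) : Prop :=
  (exists p : 'I_k.+1 -> 'rV[R]_n, (forall i, A (p i)) /\ affindep p) /\
  (forall p : 'I_k.+2 -> 'rV[R]_n, (forall i, A (p i)) -> ~ affindep p).

Definition face {n} (Q F : set 'rV[R]_n) : Prop :=
  (exists y, F y) /\
  exists (u : 'rV[R]_n) (c : R), (forall y, Q y -> c <= pair u y) /\
    F = [set y | Q y /\ pair u y = c].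

Definition facet {n} (Q F : set 'rV[R]_n) : Prop :=
  face Q F /\ exists k, affdim Q k.+1 /\ affdim F k.

Definition special_simplex {n r} (Q : set 'rV[R]_n) (nv : 'I_r -> 'rV[R]_n) : Prop :=
  (forall i, isZvec (nv i) /\ Q (nv i)) /\ affindep nv /\
  forall F, facet Q F -> #|[pred i : 'I_r | `[< F (nv i) >]]| = r.-1.

Definition in_span {n r} (nv : 'I_r -> 'rV[R]_n) (y : 'rV[R]_n) : Prop :=
  exists c : 'I_r -> R, y = \sum_(i < r) c i *: nv i.

Definition polar {n} (Q : set 'rV[R]_n) : set 'rV[R]_n :=
  [set y | forall x, Q x -> -1 <= pair x y].

Definition dual_lattice {n} (L : set 'rV[R]_n) : set 'rV[R]_n :=
  [set y | forall x, L x -> pair x y \is a Num.int].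

Definition zero_interior {n} (Q : set 'rV[R]_n) : Prop :=
  exists eps : R, 0 < eps /\ forall y : 'rV[R]_n, (forall i, `|y ord0 i| < eps) -> Q y.

Definition lattice_polytope {n} (L Q : set 'rV[R]_n) : Prop :=
  exists S : seq 'rV[R]_n, (forall v, v \in S -> L v) /\ Q = conv S.

Definition reflexive_polytope {n} (L Q : set 'rV[R]_n) : Prop :=
  lattice_polytope L Q /\ zero_interior Q /\ lattice_polytope (dual_lattice L) (polar Q).

Definition lattice_count {n} (L Q : set 'rV[R]_n) (j : nat) : nat :=
  #|` fset_set [set y | L y /\ exists q, Q q /\ y = j%:R *: q] |.

(* i-th coefficient of (1-t)^(k+1) * sum_j #(jQ ∩ L) t^j, Q of dimension k *)
Definition hstar_coef {n} (L Q : set 'rV[R]_n) (k i : nat) : int :=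
  \sum_(j < i.+1) ((-1) ^+ (i - j) * ('C(k.+1, i - j))%:Z * (lattice_count L Q j)%:Z).

End Defs.

(* Main.v *)
(* Let S generate sigma and T generate its dual. Pairing m_{sigma^\vee} with
   n_1 + ... + n_r, and using that every facet of the dual support misses one
   n_i, gives n_sigma = n_1 + ... + n_r. Hence every generator in S pairs to 1
   with exactly one n_i and to 0 with the others. Splitting an element of sigma
   according to these types yields the Minkowski description of the polar. For
   the h^*-polynomials, subtracting the n_i writes each lattice point of the dual
   cone uniquely as a reduced point plus a natural combination of the n_i; the
   reduced points of height at most j are in bijection with the lattice points of
   j P. So the r-th difference of the Ehrhart function of the dual support and
   the first difference of that of P are the same function. *)
Require Import Defs.
From HB Require Import structures.
From mathcomp Require Import all_boot all_order all_algebra finmap.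
From mathcomp Require Import boolp classical_sets cardinality reals.
From mathcomp Require Import ring lra.
Set Implicit Arguments. Unset Strict Implicit. Unset Printing Implicit Defensive.
Import Order.TTheory GRing.Theory Num.Theory.
Local Open Scope ring_scope.
Local Open Scope classical_set_scope.

(** * Bilinearity of the pairing and integral vectors *)

Section Pairing.
Context {R : realType} {n : nat}.
Implicit Types x y z : 'rV[R]_n.

Lemma pairE x y : pair x y = (x *m y^T) ord0 ord0.
Proof. by rewrite mxE; apply: eq_bigr => i _; rewrite mxE. Qed.

Lemma pairC x y : pair x y = pair y x.
Proof. by apply: eq_bigr => i _; rewrite mulrC. Qed.

Lemma pairDl x y z : pair (x + y) z = pair x z + pair y z.
Proof. by rewrite !pairE mulmxDl mxE. Qed.

Lemma pairZl a x z : pair (a *: x) z = a * pair x z.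
Proof. by rewrite !pairE -scalemxAl mxE. Qed.

Lemma pairDr x y z : pair z (x + y) = pair z x + pair z y.
Proof. by rewrite !(pairC z) pairDl. Qed.

Lemma pairZr a x z : pair z (a *: x) = a * pair z x.
Proof. by rewrite !(pairC z) pairZl. Qed.

Lemma pair0l z : pair 0 z = 0.
Proof. by rewrite pairE mul0mx mxE. Qed.

Lemma pair0r z : pair z 0 = 0.
Proof. by rewrite pairC pair0l. Qed.

Lemma pairBl x y z : pair (x - y) z = pair x z - pair y z.
Proof. by rewrite -scaleN1r pairDl pairZl mulN1r. Qed.

Lemma pairBr x y z : pair z (x - y) = pair z x - pair z y.
Proof. by rewrite !(pairC z) pairBl. Qed.

Lemma pair_suml I (s : seq I) (P : pred I) (F : I -> 'rV[R]_n) z :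
  pair (\sum_(i <- s | P i) F i) z = \sum_(i <- s | P i) pair (F i) z.
Proof. by elim/big_rec2: _ => [|i a b _ <-]; rewrite ?pair0l ?pairDl. Qed.

Lemma pair_sumr I (s : seq I) (P : pred I) (F : I -> 'rV[R]_n) z :
  pair z (\sum_(i <- s | P i) F i) = \sum_(i <- s | P i) pair z (F i).
Proof. by rewrite pairC pair_suml; apply: eq_bigr => i _; rewrite pairC. Qed.

Lemma pair_int x y : isZvec x -> isZvec y -> pair x y \is a Num.int.
Proof. by move=> hx hy; apply: rpred_sum => i _; apply: rpredM. Qed.

Lemma pair_sqr_eq0 x : pair x x = 0 -> x = 0.
Proof.
move=> /eqP; rewrite psumr_eq0; last by move=> i _; rewrite -expr2 sqr_ge0.
by move=> /allP h; apply/rowP => i; move: (h i (mem_index_enum i)); rewrite mxE /= mulf_eq0 orbb => /eqP.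
Qed.

Lemma isZvecD x y : isZvec x -> isZvec y -> isZvec (x + y).
Proof. by move=> hx hy i; rewrite mxE rpredD. Qed.

Lemma isZvecZ a x : a \is a Num.int -> isZvec x -> isZvec (a *: x).
Proof. by move=> ha hx i; rewrite mxE rpredM. Qed.

Lemma isZvecB x y : isZvec x -> isZvec y -> isZvec (x - y).
Proof. by move=> hx hy i; rewrite !mxE rpredB. Qed.

Lemma isZvec_sum I (s : seq I) (P : pred I) (F : I -> 'rV[R]_n) :
  (forall i, P i -> isZvec (F i)) -> isZvec (\sum_(i <- s | P i) F i).
Proof. by move=> h i; rewrite summxE; apply: rpred_sum => j /h. Qed.

End Pairing.

Lemma pair_mulmx {R : realType} {n p} (x : 'rV[R]_n) (A : 'M[R]_(n, p)) (y : 'rV[R]_p) :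
  pair (x *m A) y = pair x (y *m A^T).
Proof. by rewrite !pairE trmx_mul trmxK mulmxA. Qed.

Lemma int_gt0_ge1 {R : realType} (a : R) : a \is a Num.int -> 0 < a -> 1 <= a.
Proof. by move=> /intrP[m ->]; rewrite ltr0z ler1z gtz0_ge1. Qed.

(** * Finitely generated cones, their duals, and Farkas' lemma *)

Section Cones.
Context {R : realType} {n : nat}.
Implicit Types (x y v : 'rV[R]_n) (S : seq 'rV[R]_n).

Lemma cone_of_consP v S x :
  cone_of (v :: S) x <-> exists2 a, 0 <= a & cone_of S (x - a *: v).
Proof.
split=> [[c [c0 ->]]|[a a0 [c [c0 e]]]].
  exists (c ord0) => //; exists (fun i => c (lift ord0 i)); split=> //.
  by rewrite big_ord_recl /= addrC addKr.
exists (fun i => if unlift ord0 i is Some j then c j else a); split.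
  by move=> i; case: unliftP.
rewrite big_ord_recl unlift_none /= -(subrK (a *: v) x) e addrC.
by congr (_ + _); apply: eq_bigr => i _; rewrite liftK.
Qed.

(** Serves as an induction principle: a property stable under sums and nonnegative multiples need
    only be checked on generators. *)
Lemma cone_min (K : set 'rV[R]_n) S :
  K 0 -> (forall x y, K x -> K y -> K (x + y)) ->
  (forall a x, 0 <= a -> K x -> K (a *: x)) ->
  (forall v, v \in S -> K v) -> cone_of S `<=` K.
Proof.
move=> K0 KD KZ KS x [c [c0 ->]]; apply: big_ind => // i _.
by apply: KZ => //; apply/KS/mem_nth.
Qed.

Lemma cone_of0 S : cone_of S 0.
Proof. by exists (fun=> 0); split=> //; rewrite big1 // => i _; rewrite scale0r. Qed.

Lemma cone_ofD S x y : cone_of S x -> cone_of S y -> cone_of S (x + y).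
Proof.
move=> [c [c0 ->]] [e [e0 ->]]; exists (fun i => c i + e i); split.
  by move=> i; rewrite addr_ge0.
by rewrite -big_split; apply: eq_bigr => i _; rewrite scalerDl.
Qed.

Lemma cone_ofZ S a x : 0 <= a -> cone_of S x -> cone_of S (a *: x).
Proof.
move=> a0 [c [c0 ->]]; exists (fun i => a * c i); split.
  by move=> i; rewrite mulr_ge0.
by rewrite scaler_sumr; apply: eq_bigr => i _; rewrite scalerA.
Qed.

Lemma cone_of_mem S v : v \in S -> cone_of S v.
Proof.
move=> vS; have h : (index v S < size S)%N by rewrite index_mem.
exists (fun i => (i == Ordinal h)%:R); split; first by move=> i; rewrite ler0n.
rewrite (bigD1 (Ordinal h)) //= eqxx scale1r nth_index // big1 ?addr0 // => i /negbTE ->.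
by rewrite scale0r.
Qed.

Lemma cone_of_sub S S' : (forall v, v \in S -> cone_of S' v) -> cone_of S `<=` cone_of S'.
Proof.
by move=> h; apply: cone_min => //; [exact: cone_of0|exact: cone_ofD|exact: cone_ofZ].
Qed.

Lemma cone_of_ge0 S y : (forall v, v \in S -> 0 <= pair v y) ->
  forall x, cone_of S x -> 0 <= pair x y.
Proof.
move=> h; apply: (@cone_min [set x | 0 <= pair x y]) => //.
- by rewrite /= pair0l.
- by move=> x z /= hx hz; rewrite pairDl addr_ge0.
- by move=> a x a0 /=; rewrite pairZl; apply: mulr_ge0.
Qed.

Lemma dual_coneP S y :
  dual_cone (cone_of S) y <-> forall v, v \in S -> 0 <= pair v y.
Proof.
by split=> [h v /cone_of_mem /h //|h x /(cone_of_ge0 h)].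
Qed.

End Cones.

(* Bartl's proof: when [v] is needed, some [y0] is nonnegative on [S], negative
   on [x], and then negative on [v]; projecting along [v] onto [y0^⊥] reduces to
   the projected list. *)
Lemma farkas {R : realType} {n} (S : seq 'rV[R]_n) x :
  (forall y, (forall v, v \in S -> 0 <= pair v y) -> 0 <= pair x y) -> cone_of S x.
Proof.
elim: {S}(size S) {-2}S (erefl (size S)) x => [|k IH] [|v S] //= + x h.
- move=> _; suff -> : x = 0 by exact: cone_of0.
  apply: pair_sqr_eq0; apply/eqP; rewrite eq_le h // andbT.
  by rewrite -oppr_ge0 -mulN1r -pairZr h.
move=> [sS].
have [h'|] := pselect (forall y, (forall w, w \in S -> 0 <= pair w y) -> 0 <= pair x y).
  apply/cone_of_consP; exists 0 => //; rewrite scale0r subr0.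
  exact: (IH _ sS).
move=> /existsNP[y1 /not_implyP[y1S /negP]]; rewrite -ltNge => y1x.
have vy1 : pair v y1 < 0.
  rewrite ltNge; apply/negP => vy; move: y1x; rewrite ltNge h // => w.
  by rewrite inE => /predU1P[->//|/y1S].
pose y0 := (- (pair v y1)^-1) *: y1.
have vy0 : pair v y0 = -1 by rewrite pairZr mulNr mulVf // ltr0_neq0.
have c0 : 0 < - (pair v y1)^-1 by rewrite oppr_gt0 invr_lt0.
have y0S w : w \in S -> 0 <= pair w y0 by move=> /y1S; rewrite pairZr; apply: mulr_ge0; apply: ltW.
have y0x : pair x y0 < 0 by rewrite pairZr pmulr_rlt0.
clearbody y0; pose pr w := w + pair w y0 *: v.
have := IH (map pr S) _ (pr x); rewrite size_map => /(_ sS) hh.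
have {hh} : cone_of (map pr S) (pr x).
  apply: hh => y yS.
  have prE w : pair (pr w) y = pair w (y + pair v y *: y0).
    by rewrite pairDl pairDr pairZl pairZr (mulrC (pair v y)).
  rewrite prE; apply: h => w; rewrite inE => /predU1P[->|wS].
    by rewrite pairDr pairZr vy0 mulrN1 subrr.
  by rewrite -prE; apply: yS; apply: map_f.
have sub : cone_of (map pr S) `<=` [set z | exists2 a, 0 <= a & cone_of S (z - a *: v)].
  apply: cone_min.
  - by exists 0 => //; rewrite scale0r subr0; exact: cone_of0.
  - move=> p q [a a0 ha] [b b0 hb]; exists (a + b); first exact: addr_ge0.
    by rewrite scalerDl opprD addrACA; apply: cone_ofD.
  - move=> a p a0 [b b0 hb]; exists (a * b); first exact: mulr_ge0.
    by rewrite -scalerA -scalerBr; apply: cone_ofZ.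
  - move=> _ /mapP[w wS ->]; exists (pair w y0); first exact: y0S.
    by rewrite addrK; apply: cone_of_mem.
move=> /sub[a a0 ha]; apply/cone_of_consP; exists (a - pair x y0).
  by rewrite subr_ge0 (le_trans (ltW y0x)).
by rewrite scalerBl opprB addrA.
Qed.

(** * Convex hulls, their affine images and Minkowski sums *)

Section Convex.
Context {R : realType} {n : nat}.
Implicit Types (x y v : 'rV[R]_n) (S : seq 'rV[R]_n) (K : set 'rV[R]_n).

(** Combinations of any finite length are taken instead of segments, so that [conv_min] is
    immediate. *)
Definition convex K := forall k (c : 'I_k -> R) (p : 'I_k -> 'rV[R]_n),
  (forall i, 0 <= c i) -> \sum_(i < k) c i = 1 -> (forall i, K (p i)) ->
  K (\sum_(i < k) c i *: p i).

Lemma convex_translate K b : convex K -> convex [set x | K (x + b)].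
Proof.
move=> cK k c p c0 c1 hp /=; have -> : \sum_(i < k) c i *: p i + b =
    \sum_(i < k) c i *: (p i + b).
  by rewrite -[b in LHS]scale1r -c1 scaler_suml -big_split; apply: eq_bigr => i _; rewrite scalerDr.
exact: cK.
Qed.

Lemma convex_conv S : convex (conv S).
Proof.
move=> k c p c0 c1 /choice[e he].
exists (fun j => \sum_(i < k) c i * e i j); split=> [j|].
  by apply: sumr_ge0 => i _; apply: mulr_ge0 => //; case: (he i).
split.
  rewrite exchange_big -[RHS]c1; apply: eq_bigr => i _.
  by case: (he i) => _ [e1 _]; rewrite -mulr_sumr e1 mulr1.
under [RHS]eq_bigr do rewrite scaler_suml.
rewrite exchange_big; apply: eq_bigr => i _.
case: (he i) => _ [_ {1}->]; rewrite scaler_sumr; apply: eq_bigr => j _.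
by rewrite scalerA.
Qed.

Lemma conv_min K S : convex K -> (forall v, v \in S -> K v) -> conv S `<=` K.
Proof. by move=> cK KS x [c [c0 [c1 ->]]]; apply: cK => // i; apply/KS/mem_nth. Qed.

Lemma conv_mem S v : v \in S -> conv S v.
Proof.
move=> vS; have h : (index v S < size S)%N by rewrite index_mem.
exists (fun i => (i == Ordinal h)%:R); split; first by move=> i; rewrite ler0n.
split; rewrite (bigD1 (Ordinal h)) //= eqxx.
  by rewrite big1 ?addr0 // => i /negbTE ->.
by rewrite scale1r nth_index // big1 ?addr0 // => i /negbTE ->; rewrite scale0r.
Qed.

(** Pairing a conic combination with [m] returns the sum of its coefficients. *)
Lemma cone_support_conv S m : (forall v, v \in S -> pair v m = 1) ->
  cone_support (cone_of S) m = conv S.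
Proof.
move=> Sm; have e (c : 'I_(size S) -> R) :
    pair (\sum_(i < size S) c i *: S`_i) m = \sum_(i < size S) c i.
  by rewrite pair_suml; apply: eq_bigr => i _; rewrite pairZl Sm ?mulr1 // mem_nth.
apply/seteqP; split=> [x [[c [c0 ->]]]|x [c [c0 [c1 ->]]]].
  by rewrite e => c1; exists c.
by split; [exists c|rewrite e].
Qed.

(** One summand is varied at a time: translates of a convex set are convex, so each summand may be
    reduced to a listed point. *)
Lemma conv_add S1 S2 x y : conv S1 x -> conv S2 y ->
  conv [seq a + b | a <- S1, b <- S2] (x + y).
Proof.
move=> hx hy; move: x hx; set C := conv (allpairs _ _ _).
apply: (@conv_min [set x | C (x + y)]) => [|a aS /=].
  by apply: (@convex_translate C); apply: convex_conv.
rewrite addrC; move: y hy; apply: (@conv_min [set y | C (y + a)]) => [|b bS /=].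
  by apply: (@convex_translate C); apply: convex_conv.
by apply: conv_mem; rewrite addrC; apply: allpairs_f.
Qed.

End Convex.

Lemma conv_affine {R : realType} {n p} (A : 'M[R]_(n, p)) b (S : seq 'rV[R]_n) :
  conv [seq v *m A + b | v <- S] = [set y *m A + b | y in conv S].
Proof.
have e k (c : 'I_k -> R) (q : 'I_k -> 'rV[R]_n) : \sum_(i < k) c i = 1 ->
    \sum_(i < k) c i *: (q i *m A + b) = (\sum_(i < k) c i *: q i) *m A + b.
  move=> c1; rewrite -[b in RHS]scale1r -c1 scaler_suml mulmx_suml -big_split.
  by apply: eq_bigr => i _; rewrite scalerDr -scalemxAl.
apply/seteqP; split.
  apply: conv_min => [k c q c0 c1 hq|_ /mapP[v vS ->]]; last first.
    by exists v => //; apply: conv_mem.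
  have [f hf] := choice (fun i => let: ex_intro2 f h1 h2 := hq i in
     ex_intro (fun f => conv S f /\ f *m A + b = q i) f (conj h1 h2)).
  exists (\sum_(i < k) c i *: f i).
    by apply: convex_conv => // i; case: (hf i).
  by rewrite -e //; apply: eq_bigr => i _; case: (hf i) => _ ->.
move=> _ [_ [c [c0 [c1 ->]]] <-]; rewrite -e //.
by apply: convex_conv => // i; apply/conv_mem/map_f/mem_nth.
Qed.

(** All sums with one term from each list: a finite list whose hull is the Minkowski sum of the
    hulls, though it may contain points that are not vertices. *)
Fixpoint seq_sums {R : realType} {n} k : ('I_k -> seq 'rV[R]_n) -> seq 'rV[R]_n :=
  if k is k'.+1 then
    fun S => [seq a + b | a <- S ord0, b <- seq_sums (fun i => S (lift ord0 i))]
  else fun=> [:: 0].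

Lemma seq_sumsP {R : realType} {n} k (S : 'I_k -> seq 'rV[R]_n) x :
  x \in seq_sums S -> exists2 w, (forall i, w i \in S i) & x = \sum_(i < k) w i.
Proof.
elim: k S x => [|k IH] S x /=.
  by rewrite inE => /eqP ->; exists (fun=> 0); rewrite ?big_ord0 // => -[].
move=> /allpairsP[[a b] /= [aS /IH[w wS ->] ->]].
exists (fun i => if unlift ord0 i is Some j then w j else a).
  by move=> i; case: unliftP => [j|] ->.
rewrite big_ord_recl unlift_none; congr (_ + _); apply: eq_bigr => i _.
by rewrite liftK.
Qed.

Lemma conv_seq_sums {R : realType} {n} k (S : 'I_k -> seq 'rV[R]_n) (z : 'I_k -> 'rV[R]_n) :
  (forall i, conv (S i) (z i)) -> conv (seq_sums S) (\sum_(i < k) z i).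
Proof.
elim: k S z => [|k IH] S z h /=.
  by rewrite big_ord0; apply: conv_mem; rewrite inE.
by rewrite big_ord_recl; apply: conv_add => //; apply: IH => i; apply: h.
Qed.

(** * Affine dimension through ranks of matrices *)

Section AffineDimension.
Context {R : realType} {n : nat}.
Implicit Types (y m : 'rV[R]_n) (S : seq 'rV[R]_n) (F : set 'rV[R]_n).

Lemma affindepN (p : 'I_n.+2 -> 'rV[R]_n) : ~ affindep p.
Proof.
(* Appending a coordinate 1 turns affine relations into linear ones, and [n + 2] rows cannot be free
   in dimension [n + 1]. *)
move=> h; pose M : 'M[R]_(n.+2, n + 1) := row_mx (\matrix_i p i) (const_mx 1).
have : row_free M; last first.
  by move=> /eqP e; have := rank_leq_col M; rewrite e addn1 ltnn.
apply: inj_row_free => v; rewrite mul_mx_row -row_mx0 => /eq_row_mx[v0 v1].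
apply/rowP => i; rewrite mxE; apply: (h (fun i => v ord0 i)).
  have /rowP/(_ ord0) := v1; rewrite !mxE => e; rewrite -[RHS]e.
  by apply: eq_bigr => j _; rewrite mxE mulr1.
rewrite -[RHS]v0 mulmx_sum_row.
by apply: eq_bigr => j _; rewrite rowK.
Qed.

Lemma affdim_zero_interior F : zero_interior F -> affdim F n.
Proof.
move=> [eps [e0 h]]; split; last by move=> p _; apply: affindepN.
pose p (i : 'I_n.+1) : 'rV[R]_n :=
  if unlift ord0 i is Some j then (eps / 2) *: delta_mx ord0 j else 0.
have e2 : 0 < eps / 2 by rewrite divr_gt0.
exists p; split=> [i|c c0].
  apply: h => j; rewrite /p; case: unliftP => [k _|_]; rewrite !mxE ?normr0 //.
  rewrite eqxx /=; case: (j == k); rewrite ?mulr0 ?normr0 // mulr1 gtr0_norm //.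
  by rewrite ltr_pdivrMr // ltr_pMr // ltr1n.
rewrite big_ord_recl {1}/p unlift_none scaler0 add0r => e.
have cS j : c (lift ord0 j) = 0.
  move/rowP: e => /(_ j); rewrite summxE mxE (bigD1 j) //= /p liftK !mxE !eqxx /= mulr1.
  rewrite big1 => [|k kj]; last first.
    by rewrite /p liftK !mxE [j == k]eq_sym (negbTE kj) andbF !mulr0.
  by rewrite addr0 => /eqP; rewrite mulf_eq0 (gt_eqF e2) orbF => /eqP.
move=> i; case: (unliftP ord0 i) => [j ->//|->].
by move: c0; rewrite big_ord_recl big1 ?addr0.
Qed.

(** On the hyperplane at height 1 every linear relation is affine: pairing it with [m] shows that
    its coefficients add up to 0. *)
Lemma affindep_row_free k (p : 'I_k -> 'rV[R]_n) m :
  (forall i, pair m (p i) = 1) -> affindep p <-> row_free (\matrix_i p i).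
Proof.
move=> pm; split=> [h|/row_free_inj inj c _ e i].
  apply: inj_row_free => v; rewrite mulmx_sum_row => e.
  have {}e : \sum_i v ord0 i *: p i = 0.
    by rewrite -[RHS]e; apply: eq_bigr => i _; rewrite rowK.
  apply/rowP => i; rewrite mxE; apply: (h (fun i => v ord0 i)) => //.
  have := congr1 (pair m) e; rewrite pair_sumr pair0r => e'; rewrite -[RHS]e'.
  by apply: eq_bigr => j _; rewrite pairZr pm mulr1.
have /rowP/(_ i) : \row_i c i = 0; last by rewrite !mxE.
apply: inj; rewrite mul0mx mulmx_sum_row -[RHS]e; apply: eq_bigr => j _.
by rewrite rowK mxE.
Qed.

Definition seqmx S : 'M[R]_(size S, n) := \matrix_(i < size S) S`_i.

Lemma affdim_seqmx F S m k : (forall y, F y -> pair m y = 1) ->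
  (forall v, v \in S -> F v) -> (forall y, F y -> (y <= seqmx S)%MS) ->
  \rank (seqmx S) = k.+1 -> affdim F k.
Proof.
move=> Fm SF FS rk; split.
  have := maxrowsub_free (seqmx S); move: (maxrankfun _); rewrite rk => f free.
  exists (fun i => S`_(f i)).
  have Ff i : F S`_(f i) by apply/SF/mem_nth.
  split=> //; apply/(affindep_row_free (m := m)) => [i|]; first exact: Fm.
  congr (row_free _): free.
  by apply/row_matrixP => i; rewrite row_rowsub !rowK.
move=> p Fp /(affindep_row_free (fun i => Fm _ (Fp i))) /eqP e.
have : (\matrix_i p i <= seqmx S)%MS by apply/row_subP => i; rewrite rowK; apply: FS.
by move=> /mxrankS; rewrite e rk ltnn.
Qed.

End AffineDimension.

(** Allows small perturbations: finitely many inequalities [0 <= g w] survive adding [eps * f w] of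
    either sign, provided [f] vanishes wherever they are tight. *)
Lemma small_scale {R : realType} (I : eqType) (s : seq I) (f g : I -> R) :
  (forall w, w \in s -> 0 <= g w) -> (forall w, w \in s -> g w = 0 -> f w = 0) ->
  exists2 eps, 0 < eps & forall w, w \in s -> eps * `|f w| <= g w.
Proof.
elim: s => [|w s IH] g0 fg; first by exists 1.
have [v vs|v vs|eps e0 h] := IH.
- by apply: g0; rewrite inE vs orbT.
- by apply: fg; rewrite inE vs orbT.
have [fw|fw] := eqVneq (f w) 0.
  exists eps => // v; rewrite inE => /predU1P[->|/h//].
  by rewrite fw normr0 mulr0 g0 ?mem_head.
have gw : 0 < g w.
  rewrite lt_neqAle g0 ?mem_head // andbT eq_sym; apply: contraNneq fw => gw.
  by apply/eqP/fg; rewrite ?mem_head.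
exists (Num.min eps (g w / `|f w|)).
  by rewrite lt_min e0 divr_gt0 ?normr_gt0.
move=> v; rewrite inE => /predU1P[->|vs].
  by rewrite -ler_pdivlMr ?normr_gt0 // ge_min lexx orbT.
by apply: le_trans (h _ vs); rewrite ler_wpM2r // ge_min lexx.
Qed.

(** * Irredundant generators and extreme rays *)

Section Generators.
Context {R : realType} {n : nat}.
Implicit Types (S T : seq 'rV[R]_n) (u v x y : 'rV[R]_n).

Lemma cone_of_rem S v x : v \in S -> cone_of S x ->
  exists2 a, 0 <= a & cone_of (rem v S) (x - a *: v).
Proof.
move=> vS hx; apply/cone_of_consP; apply: cone_of_sub hx => w.
by rewrite (perm_mem (perm_to_rem vS)); apply: cone_of_mem.
Qed.

Lemma minimal_generators S : exists S', [/\ {subset S' <= S},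
  cone_of S' = cone_of S & forall v, v \in S' -> ~ cone_of (rem v S') v].
Proof.
elim: {S}(size S) {-2}S (leqnn (size S)) => [|k IH] S sS.
  by move: sS; rewrite leqn0 => /nilP ->; exists [::].
have [[v vS hv]|h] := pselect (exists2 v, v \in S & cone_of (rem v S) v); last first.
  by exists S; split=> // v vS hv; apply: h; exists v.
have [|S' [sub e mn]] := IH (rem v S).
  by rewrite size_rem // -ltnS prednK ?(leq_ltn_trans (leq0n _) (_ : index v S < size S)%N) // index_mem.
exists S'; split=> // [w /sub /mem_rem//|]; rewrite e; apply/seteqP; split.
  by apply: cone_of_sub => w /mem_rem; apply: cone_of_mem.
apply: cone_of_sub => w; rewrite (perm_mem (perm_to_rem vS)) inE.
by move=> /predU1P[->//|]; apply: cone_of_mem.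
Qed.

Lemma cone_of_height0 S h x : (forall v, v \in S -> pair v h = 1) ->
  cone_of S x -> pair x h = 0 -> x = 0.
Proof.
move=> Sh [c [c0 ->]]; rewrite pair_suml => e.
rewrite big1 // => i _; suff -> : c i = 0 by rewrite scale0r.
have /eqP := e; rewrite psumr_eq0 => [|j _]; last first.
  by rewrite pairZl Sh ?mem_nth // mulr1.
move=> /allP/(_ i (mem_index_enum i)) /=.
by rewrite pairZl Sh ?mem_nth // mulr1 => /eqP.
Qed.

(** Write [v + u = a v + p] and [v - u = b v + q] with [p], [q] in the cone of the other generators,
    so [p + q = (2 - a - b) v]. If [a + b < 2], then [v] is redundant; otherwise heights force
    [p = 0], hence [u = (a - 1) v]. *)
Lemma minimal_extreme S h v u : (forall v, v \in S -> pair v h = 1) -> v \in S ->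
  ~ cone_of (rem v S) v -> cone_of S (v + u) -> cone_of S (v - u) ->
  exists a, u = a *: v.
Proof.
move=> Sh vS vmin /(cone_of_rem vS)[a a0 hp] /(cone_of_rem vS)[b b0 hq].
have rS w : w \in rem v S -> pair w h = 1 by move=> /mem_rem/Sh.
have pq : (v + u - a *: v) + (v - u - b *: v) = (2 - (a + b)) *: v.
  by rewrite addrACA [v + u + _]addrACA subrr addr0 -opprD -scalerDl scalerBl scaler_nat.
have hpq := cone_ofD hp hq; rewrite pq in hpq.
have [ab|ab] := ltP (a + b) 2.
  exfalso; apply: vmin; have ab' : 0 < 2 - (a + b) by rewrite subr_gt0.
  rewrite -[v in X in cone_of _ X]scale1r -(mulVf (lt0r_neq0 ab')) -scalerA.
  by apply: cone_ofZ => //; rewrite invr_ge0 ltW.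
have hp0 : 0 <= pair (v + u - a *: v) h.
  by apply: cone_of_ge0 hp => w /rS ->; rewrite ler01.
have hq0 : 0 <= pair (v - u - b *: v) h.
  by apply: cone_of_ge0 hq => w /rS ->; rewrite ler01.
have := congr1 (fun x => pair x h) pq; rewrite /= pairDl pairZl (Sh v vS) mulr1 => e.
have hp1 : pair (v + u - a *: v) h = 0.
  apply/eqP; rewrite eq_le hp0 andbT; move: e ab hp0 hq0.
  lra.
have /subr0_eq vu := cone_of_height0 rS hp hp1.
by exists (a - 1); rewrite scalerBl scale1r -vu addrC addKr.
Qed.

End Generators.

(** * Facets of the dual support, and [nsig] as the sum of the simplex vertices *)

Section ReflexiveCone.
Context {R : realType} {d r : nat} {S T : seq 'rV[R]_d.+1} {nsig msig : 'rV[R]_d.+1}.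
Hypothesis Sgen : forall v, v \in S -> isZvec v /\ pair v nsig = 1.
Hypothesis Tgen : forall w, w \in T -> isZvec w /\ pair w msig = 1.
Hypothesis Sfull : fulldim (cone_of S).
Hypothesis Tfull : fulldim (cone_of T).
Hypothesis dualST : dual_cone (cone_of S) = cone_of T.
Hypothesis mn_r : pair msig nsig = r%:R.

(** Biduality of the cone, by Farkas' lemma. *)
Lemma conesP x : cone_of S x <-> forall w, w \in T -> 0 <= pair x w.
Proof.
split=> [hx w /cone_of_mem|hx]; first by rewrite -dualST; apply.
apply: farkas => y /dual_coneP; rewrite dualST => hy; rewrite pairC.
by apply: cone_of_ge0 hy => w /hx; rewrite pairC.
Qed.

Lemma conetP y : cone_of T y <-> forall v, v \in S -> 0 <= pair v y.
Proof. by rewrite -dualST; apply: dual_coneP. Qed.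

Lemma cone_S_msig : cone_of S msig.
Proof. by apply/conesP => w /Tgen[_]; rewrite pairC => ->; exact: ler01. Qed.

Lemma fulldim_seqmx (s : seq 'rV[R]_d.+1) : fulldim (cone_of s) -> row_full (seqmx s).
Proof.
have sub x : cone_of s x -> (x <= seqmx s)%MS.
  move=> [c [_ ->]]; apply: summx_sub => i _; apply: scalemx_sub.
  by rewrite -[s`_i](rowK (fun i : 'I_(size s) => s`_i)) row_sub.
move=> h; rewrite -sub1mx; apply/row_subP => i; have [a [b [/sub ha [/sub hb ->]]]] := h (row i 1%:M).
by rewrite addmx_sub // eqmx_opp.
Qed.

(** Index 0 would put [msig] at height 0 of the cone, so [msig = 0]; but it pairs to 1 with the
    elements of [T], and [T] is nonempty because it spans a space of positive dimension. *)
Lemma index_gt0 : (0 < r)%N.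
Proof.
rewrite lt0n; apply/eqP => r0.
have m0 : msig = 0 by apply: cone_of_height0 (fun v vS => proj2 (Sgen vS)) cone_S_msig _; rewrite mn_r r0.
have /eqP := fulldim_seqmx Tfull; case: {-1}T (erefl T) => [|w T' eT].
  by move=> _; have := rank_leq_row (seqmx ([::] : seq 'rV[R]_d.+1)) => /[swap] ->.
have := @Tgen w; rewrite eT mem_head m0 pair0r => /(_ isT)[_ /eqP].
by rewrite eq_sym oner_eq0.
Qed.

(** All inequalities defining the cone are strict at [msig], where they take the value 1. *)
Lemma msig_interior (v : 'rV[R]_d.+1) : exists2 eps, 0 < eps & cone_of S (msig - eps *: v).
Proof.
have [w|w|eps e0 h] := @small_scale R _ T (pair v) (pair msig).
- by move=> /Tgen[_]; rewrite pairC => ->; exact: ler01.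
- by move=> /Tgen[_]; rewrite pairC => -> /eqP; rewrite oner_eq0.
exists eps => //; apply/conesP => w /h; rewrite pairBl pairZl subr_ge0.
by apply: le_trans; rewrite ler_wpM2l ?ler_norm // ltW.
Qed.

Lemma Nabla_submx (y : 'rV[R]_d.+1) : (y <= seqmx T)%MS.
Proof. exact: submx_full (fulldim_seqmx Tfull). Qed.

Lemma affdim_Nabla : affdim (cone_support (cone_of T) msig) d.
Proof.
apply: (@affdim_seqmx _ _ _ T msig) => [y [_]|v vT|y _|].
- by rewrite pairC.
- by split; [apply: cone_of_mem|case: (Tgen vT)].
- exact: Nabla_submx.
- exact/eqP/(fulldim_seqmx Tfull).
Qed.

Context {nv : 'I_r -> 'rV[R]_d.+1}.
Hypothesis nv_special : special_simplex (cone_support (cone_of T) msig) nv.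

Lemma nvZ i : isZvec (nv i).
Proof. by case: nv_special => /(_ i)[]. Qed.

Lemma pair_msig_nv i : pair msig (nv i) = 1.
Proof. by rewrite pairC; case: nv_special => /(_ i)[_ []]. Qed.

Lemma pair_nv_ge0 v i : cone_of S v -> 0 <= pair v (nv i).
Proof.
by move: v; apply: cone_of_ge0; apply/conetP; case: nv_special => /(_ i)[_ []].
Qed.

Section Minimal.
Hypothesis Smin : forall v, v \in S -> ~ cone_of (rem v S) v.

(* If the T-vectors orthogonal to [v] did not span the hyperplane [v^⊥], some
   [u] not proportional to [v] would be orthogonal to all of them, and
   [v ± eps u] would lie in the cone, contradicting that [v] spans an extreme ray. *)
Lemma rank_facet v : v \in S -> \rank (seqmx [seq w <- T | pair v w == 0]) = d.
Proof.
move=> vS; set W := [seq w <- T | _]; set B := seqmx W.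
have v0 : v != 0.
  by apply: contraPneq (proj2 (Sgen vS)) => ->; rewrite pair0l => /eqP; rewrite eq_sym oner_eq0.
have vT w : w \in T -> 0 <= pair v w by move: w; apply/conesP/cone_of_mem.
have Bv : (B <= kermx v^T)%MS.
  apply/row_subP => i; rewrite rowK; apply/sub_kermxP/matrixP => a b; rewrite !ord1 -pairE mxE pairC.
  by have := mem_nth 0 (ltn_ord i); rewrite mem_filter => /andP[/eqP].
have Kv : (kermx B^T <= v)%MS.
  apply/row_subP => i; set u := row i _.
  have uB w : w \in T -> pair v w = 0 -> pair u w = 0.
    move=> wT vw; have wW : w \in W by rewrite mem_filter wT vw eqxx.
    have h : (index w W < size W)%N by rewrite index_mem.
    have /sub_kermxP : (u <= kermx B^T)%MS by apply: row_sub.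
    move=> /rowP/(_ (Ordinal h)); rewrite !mxE => e; rewrite -[RHS]e.
    by apply: eq_bigr => j _; rewrite !mxE nth_index.
  have [eps e0 he] := small_scale (f := pair u) vT uB.
  have [|||a ea] := @minimal_extreme _ _ S nsig v (eps *: u) _ vS (Smin vS).
  - by move=> w /Sgen[].
  - apply/conesP => w wT; have := he w wT; rewrite pairDl pairZl.
    have := ler_norm (- pair u w); rewrite normrN => h1 h2.
    by have := ler_wpM2l (ltW e0) h1; lra.
  - apply/conesP => w wT; have := he w wT; rewrite pairBl pairZl.
    by have := ler_wpM2l (ltW e0) (ler_norm (pair u w)); lra.
  by rewrite -[u]scale1r -(mulVf (lt0r_neq0 e0)) -scalerA ea scalerA scalemx_sub.
have rv : \rank v = 1%N by rewrite rank_rV v0.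
have := mxrankS Bv; have := mxrankS Kv; rewrite !mxrank_ker !mxrank_tr rv.
rewrite leq_subLR addn1 ltnS subSS subn0 => h1 h2.
by apply/eqP; rewrite eqn_leq h1 h2.
Qed.

(** By [rank_facet], the elements of [T] orthogonal to [v] span the whole hyperplane orthogonal to
    [v], so the face has dimension [d - 1]. *)
Lemma facet_generator v : v \in S -> (0 < d)%N ->
  facet (cone_support (cone_of T) msig)
    [set y | cone_support (cone_of T) msig y /\ pair v y = 0].
Proof.
move=> vS d0; have rk := rank_facet vS; set W := [seq w <- T | _] in rk.
have WF w : w \in W -> cone_support (cone_of T) msig w /\ pair v w = 0.
  rewrite mem_filter => /andP[/eqP vw wT]; split=> //.
  by split; [apply: cone_of_mem|case: (Tgen wT)].
split; last first.
  exists d.-1; rewrite prednK //; split; first exact: affdim_Nabla.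
  apply: (@affdim_seqmx _ _ _ W msig) => [y [[_ <-] _]|//|y [_ vy]|]; last by rewrite rk prednK.
    by rewrite pairC.
  have sub : (seqmx W <= kermx v^T)%MS.
    apply/row_subP => i; rewrite rowK; apply/sub_kermxP/matrixP => a b.
    rewrite !ord1 -pairE mxE pairC.
    by have := mem_nth 0 (ltn_ord i); rewrite mem_filter => /andP[/eqP].
  have rv : \rank v = 1%N.
    rewrite rank_rV; case: eqP (proj2 (Sgen vS)) => // ->; rewrite pair0l => /eqP.
    by rewrite eq_sym oner_eq0.
  have /eqmxP : (seqmx W == kermx v^T)%MS.
    by rewrite -(geq_leqif (mxrank_leqif_eq sub)) rk mxrank_ker mxrank_tr rv subSS subn0.
  move=> ->; apply/sub_kermxP/matrixP => a b.
  by rewrite !ord1 -pairE mxE pairC.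
split.
  exists W`_0; apply/WF/mem_nth; rewrite lt0n; apply: contraTneq d0 => W0.
  by have := rank_leq_row (seqmx W); rewrite rk W0 leqn0 => /eqP ->.
exists v, 0; split=> // y [hy _].
by move: hy => /conetP/(_ v vS).
Qed.


(** The functional [s - nsig] is nonnegative on the cone and vanishes at its interior point [msig],
    so it vanishes on the cone, which spans the space. *)
Lemma sum_simplex_minimal : \sum_(i < r) nv i = nsig.
Proof.
set s := \sum_(i < r) nv i.
have ms : pair msig s = pair msig nsig.
  rewrite mn_r pair_sumr (eq_bigr (fun=> 1)) => [|i _]; last exact: pair_msig_nv.
  by rewrite sumr_const card_ord.
(* For [d = 0] the support of the dual is a point without facets; there the pairing is a product of
   scalars and [msig] is nonzero, so [ms] suffices. *)
have [d0|d0] := posnP d.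
  have ord_eq (i j : 'I_d.+1) : i = j.
    have lt0 (k : 'I_d.+1) : k = 0%N :> nat.
      by apply/eqP; rewrite -leqn0; apply: leq_trans (leq_ord k) _; rewrite d0.
    by apply: val_inj; rewrite /= !lt0.
  have pair1 (x y : 'rV[R]_d.+1) : pair x y = x ord0 ord0 * y ord0 ord0 :> R.
    by rewrite /pair (bigD1 ord0) //= big1 ?addr0 // => i /eqP[]; apply: ord_eq.
  have m0 : msig ord0 ord0 != 0.
    apply/eqP => m0; move: mn_r; rewrite pair1 m0 mul0r => /esym/eqP.
    by rewrite pnatr_eq0 eqn0Ngt index_gt0.
  by apply/rowP => i; rewrite (ord_eq i ord0); move: ms; rewrite !pair1 => /(mulfI m0).
have ge1 v : v \in S -> 1 <= pair v s.
  move=> vS; have [_ [_ /(_ _ (facet_generator vS d0)) c]] := nv_special.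
  have vnv i : 0 <= pair v (nv i) by apply/pair_nv_ge0/cone_of_mem.
  (* Otherwise the facet cut out by [v] would contain all [r] vertices of the simplex instead of
     [r - 1]. *)
  have [j vj] : exists j, 0 < pair v (nv j).
    apply: contrapT => h; have /eqP := c; rewrite (_ : #|_| = r); last first.
      rewrite -[RHS]card_ord; apply: eq_card => i; rewrite !inE; apply/asboolP.
      split; first by case: nv_special => /(_ i)[].
      by apply/eqP; rewrite eq_le vnv andbT leNgt; apply/negP => hi; apply: h; exists i.
    by move: index_gt0; case: (r) => // k _; rewrite gtn_eqF.
  rewrite pair_sumr (bigD1 j) //= -[1]addr0 lerD ?sumr_ge0 //.
  by apply: int_gt0_ge1 => //; apply: pair_int; [case: (Sgen vS)|exact: nvZ].
have f0 x : cone_of S x -> 0 <= pair x (s - nsig).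
  by apply: cone_of_ge0 => v vS; rewrite pairBr subr_ge0 (proj2 (Sgen vS)) ge1.
have f1 x : cone_of S x -> pair x (s - nsig) = 0.
  (* Moving from [msig] by [- eps x] stays in the cone, so the functional is also at most 0 at
     [x]. *)
  have [eps e0 he] := msig_interior x; move=> /f0 hx; apply/eqP; rewrite eq_le hx andbT.
  have := f0 _ he; rewrite pairBl pairZl [pair msig _]pairBr ms subrr sub0r oppr_ge0.
  by rewrite pmulr_rle0.
apply/subr0_eq/pair_sqr_eq0; have [x [y [/f1 hx [/f1 hy {1}->]]]] := Sfull (s - nsig).
by rewrite pairBl hx hy subrr.
Qed.

End Minimal.


End ReflexiveCone.

(** * The type of a generator: the unique simplex vertex to which it pairs nontrivially *)

Section Simplex.
Context {R : realType} {d r : nat} {S T : seq 'rV[R]_d.+1} {nsig msig : 'rV[R]_d.+1}.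
Context {nv : 'I_r -> 'rV[R]_d.+1}.
Hypothesis Sgen : forall v, v \in S -> isZvec v /\ pair v nsig = 1.
Hypothesis Tgen : forall w, w \in T -> isZvec w /\ pair w msig = 1.
Hypothesis Sfull : fulldim (cone_of S).
Hypothesis Tfull : fulldim (cone_of T).
Hypothesis dualST : dual_cone (cone_of S) = cone_of T.
Hypothesis mn_r : pair msig nsig = r%:R.
Hypothesis nv_special : special_simplex (cone_support (cone_of T) msig) nv.

(** The conclusion depends on the cone only, so [S] may be replaced by an irredundant sublist. *)
Lemma sum_simplex : \sum_(i < r) nv i = nsig.
Proof.
have [S' [sub e mn]] := minimal_generators S.
apply: (@sum_simplex_minimal _ _ _ S' T nsig msig) => //.
- by move=> v /sub/Sgen.
- by rewrite e.
- by rewrite e.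
Qed.

(* The pairings of a generator with the n_i are nonnegative integers adding up to 1. *)
Lemma generator_type v : v \in S ->
  exists i, forall j, pair v (nv j) = (j == i)%:R.
Proof.
move=> vS.
have vnv i : 0 <= pair v (nv i) by apply/(pair_nv_ge0 dualST nv_special)/cone_of_mem.
have vZ i : pair v (nv i) \is a Num.int.
  by apply: pair_int; [case: (Sgen vS)|exact: (nvZ nv_special)].
have e : \sum_(i < r) pair v (nv i) = 1.
  by rewrite -pair_sumr sum_simplex; case: (Sgen vS).
have [i vi] : exists i, pair v (nv i) != 0.
  apply: contrapT => h; move/eqP: e; rewrite big1 1?eq_sym ?oner_eq0 // => i _.
  by apply/eqP; apply: contrapT => hi; apply: h; exists i; apply/negP.
have vi1 : 1 <= pair v (nv i) by apply: int_gt0_ge1; rewrite // lt_neqAle eq_sym vi vnv.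
exists i => j; move: e; rewrite (bigD1 i) //= => e.
have s0 : 0 <= \sum_(k < r | k != i) pair v (nv k) by apply: sumr_ge0.
have [->|ji] := eqVneq j i; first by suff -> : pair v (nv i) = 1 by []; lra.
have : \sum_(k < r | k != i) pair v (nv k) = 0 by lra.
by move=> /eqP; rewrite psumr_eq0 => [|//] /allP/(_ j (mem_index_enum j)); rewrite ji => /eqP.
Qed.

(** Without a generator of type [i], [- nv i] would be nonnegative on the cone, yet it pairs to -1
    with [msig]. *)
Lemma simplex_has_type i : exists2 v, v \in S & forall j, pair v (nv j) = (j == i)%:R.
Proof.
apply: contrapT => h.
have f0 x : cone_of S x -> 0 <= pair x (- nv i).
  apply: cone_of_ge0 => v vS; have [k hk] := generator_type vS.
  rewrite -scaleN1r pairZr hk; case: eqP => [ki|]; last by rewrite mulr0.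
  by case: h; exists v => //; rewrite ki.
have := f0 _ (cone_S_msig Tgen dualST).
by rewrite -scaleN1r pairZr (pair_msig_nv nv_special) mulr1 oppr_ge0 ler10.
Qed.

End Simplex.

(** * The projected polytope: interior point, polar, and reflexivity *)

Section Projection.
Context {R : realType} {d r e : nat} {S T : seq 'rV[R]_d.+1} {nsig msig : 'rV[R]_d.+1}.
Context {nv : 'I_r -> 'rV[R]_d.+1} {A : 'M[R]_(d.+1, e)}.
Hypothesis Sgen : forall v, v \in S -> isZvec v /\ pair v nsig = 1.
Hypothesis Tgen : forall w, w \in T -> isZvec w /\ pair w msig = 1.
Hypothesis Sfull : fulldim (cone_of S).
Hypothesis Tfull : fulldim (cone_of T).
Hypothesis dualST : dual_cone (cone_of S) = cone_of T.
Hypothesis mn_r : pair msig nsig = r%:R.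
Hypothesis msigZ : isZvec msig.
Hypothesis nv_special : special_simplex (cone_support (cone_of T) msig) nv.
Hypothesis kerA : forall y : 'rV[R]_d.+1, y *m A = 0 <-> in_span nv y.
Hypothesis rkA : \rank A = e.

Let sum_nv := sum_simplex Sgen Tgen Sfull Tfull dualST mn_r nv_special.
Let gen_type := generator_type Sgen Tgen Sfull Tfull dualST mn_r nv_special.
Let Nabla := cone_support (cone_of T) msig.
Let x0 := r%:R^-1 *: nsig.
Let P := [set y *m A | y in Nabla].
(** A linear section of the projection: [y *m B] lifts [y], and [B^T] inverts [A^T] on the
    annihilator of the simplex. *)
Let B := pinvmx A.
(** The generators of type [i]; their hull is the [i]-th Cayley factor. *)
Let vertices i := [seq v <- S | pair v (nv i) == 1].

Lemma r_neq0 : r%:R != 0 :> R.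
Proof. by rewrite pnatr_eq0 -lt0n (index_gt0 Sgen Tgen Tfull dualST mn_r). Qed.

Lemma nvA i : nv i *m A = 0.
Proof.
apply/kerA; exists (fun j => (j == i)%:R).
rewrite (bigD1 i) //= eqxx scale1r big1 ?addr0 // => j /negbTE ->.
by rewrite scale0r.
Qed.

Lemma nsigA : nsig *m A = 0.
Proof. by rewrite -sum_nv mulmx_suml big1 // => i _; apply: nvA. Qed.

(** The [nv i] lie at height 1, so affine independence makes them a basis of the kernel of [A]. *)
Lemma rank_quotient : (r + e = d.+1)%N.
Proof.
set N := \matrix_i nv i.
have /eqP rN : row_free N.
  apply/(affindep_row_free (m := msig)) => [i|].
    exact: pair_msig_nv nv_special _.
  by case: nv_special => _ [].
have eN : (N == kermx A)%MS.
  apply/andP; split; apply/row_subP => i; first by rewrite rowK; apply/sub_kermxP/nvA.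
  have /sub_kermxP/kerA[c ->] : (row i (kermx A) <= kermx A)%MS by apply: row_sub.
  by apply: summx_sub => j _; apply: scalemx_sub; rewrite -[nv j](rowK nv) row_sub.
have := eqmx_rank eN; rewrite rN mxrank_ker rkA => ->.
by rewrite subnK // -rkA rank_leq_row.
Qed.

Lemma pinvA : B *m A = 1%:M.
Proof. by apply: mulVpmx; rewrite /row_full rkA. Qed.

Lemma pinvAT (m : 'rV[R]_e) : m *m A^T *m B^T = m.
Proof. by rewrite -mulmxA -trmx_mul pinvA trmx1 mulmx1. Qed.

Lemma pair_nv_AT i (m : 'rV[R]_e) : pair (nv i) (m *m A^T) = 0.
Proof. by rewrite -pair_mulmx nvA pair0l. Qed.

(** A rank count identifies the row space of [A^T] with the annihilator of the kernel of [A]. *)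
Lemma annihilatorP y : (forall i, pair y (nv i) = 0) -> y *m B^T *m A^T = y.
Proof.
move=> hy; have sub : (A^T <= kermx (kermx A)^T)%MS.
  by apply/sub_kermxP; rewrite -trmx_mul mulmx_ker trmx0.
have /eqmxP eA : (A^T == kermx (kermx A)^T)%MS.
  rewrite -(geq_leqif (mxrank_leqif_eq sub)) !(mxrank_ker, mxrank_tr) subKn //.
  exact: rank_leq_row.
have : (y <= A^T)%MS.
  rewrite eA; apply/sub_kermxP/rowP => j; rewrite mxE [RHS]mxE.
  have /sub_kermxP/kerA[c ec] : (row j (kermx A) <= kermx A)%MS by apply: row_sub.
  transitivity (pair y (row j (kermx A))).
    by apply: eq_bigr => i _; rewrite !mxE.
  by rewrite ec pair_sumr big1 // => i _; rewrite pairZr hy mulr0.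
by move=> /submxP[m ->]; rewrite pinvAT.
Qed.

(** Since [msig] is 1 on [Nabla], the bound -1 on [P] becomes nonnegativity of [m *m A^T + msig] on
    the dual cone. *)
Lemma polarP m : polar P m <-> cone_of S (m *m A^T + msig).
Proof.
split=> [h|/(conesP dualST) h _ [y [hy ym] <-]].
  apply/(conesP dualST) => w wT.
  have := h (w *m A) (ex_intro2 _ _ w (conj (cone_of_mem wT) (proj2 (Tgen wT))) erefl).
  rewrite pair_mulmx pairDl [pair msig _]pairC (proj2 (Tgen wT)) pairC => h'.
  by rewrite -lerBlDr sub0r.
rewrite pair_mulmx -subr_ge0 opprK -[in X in _ + X]ym -pairDr.
by move: hy; apply: cone_of_ge0 => w /h; rewrite pairC.
Qed.

Lemma vertices_face i x : conv (vertices i) x ->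
  cone_support (cone_of S) nsig x /\ forall j, j != i -> pair x (nv j) = 0.
Proof.
rewrite -(@cone_support_conv _ _ _ (nv i)) => [|v]; last first.
  by rewrite mem_filter => /andP[/eqP].
move=> [hx x1].
have hx0 j : j != i -> pair x (nv j) = 0.
  move=> ji; move: hx; apply: (@cone_min _ _ [set x | pair x (nv j) = 0]).
  - exact: pair0l.
  - by move=> y z /= hy hz; rewrite pairDl hy hz addr0.
  - by move=> a y _ /= hy; rewrite pairZl hy mulr0.
  - move=> v; rewrite mem_filter => /andP[/eqP vi /gen_type[k hk]].
    move: vi; rewrite /= !hk; case: eqP => [<- _|_ /eqP]; last by rewrite eq_sym oner_eq0.
    by rewrite (negbTE ji).
split=> //; split.
  by apply: cone_of_sub hx => v; rewrite mem_filter => /andP[_]; apply: cone_of_mem.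
by rewrite -sum_nv pair_sumr (bigD1 i) //= x1 big1 ?addr0.
Qed.

(* The coefficients of [z i] are those of [x], restricted to the generators
   pairing to 1 with [nv i]. *)
Lemma cayley_decomposition x : cone_of S x -> (forall i, pair x (nv i) = 1) ->
  exists2 z, (forall i, conv (vertices i) (z i)) & x = \sum_(i < r) z i.
Proof.
move=> [c [c0 xE]] x1.
exists (fun i => \sum_(k < size S) (c k * pair S`_k (nv i)) *: S`_k).
  move=> i; rewrite -(@cone_support_conv _ _ _ (nv i)) => [|v]; last first.
    by rewrite mem_filter => /andP[/eqP].
  split.
    apply: big_ind => [||k _]; [exact: cone_of0|exact: cone_ofD|].
    have [j hj] := gen_type (mem_nth 0 (ltn_ord k)).
    rewrite hj; case: eqP => [ij|_]; last by rewrite mulr0 scale0r; exact: cone_of0.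
    rewrite mulr1; apply: cone_ofZ => //; apply: cone_of_mem.
    by rewrite mem_filter mem_nth // hj ij !eqxx.
  rewrite -[RHS](x1 i) xE !pair_suml; apply: eq_bigr => k _.
  rewrite !pairZl; have [j ->] := gen_type (mem_nth 0 (ltn_ord k)).
  by case: eqP; rewrite ?mulr1 ?mulr0.
rewrite exchange_big xE; apply: eq_bigr => k _.
rewrite -scaler_suml -mulr_sumr -pair_sumr sum_nv (proj2 (Sgen _)) ?mulr1 //.
exact: mem_nth.
Qed.

Lemma polar_minkowski (Delta_i := fun i : 'I_r => [set x |
    cone_support (cone_of S) nsig x /\ forall j : 'I_r, j != i -> pair x (nv j) = 0]) :
  [set m *m A^T | m in polar P] =
    [set y | exists z : 'I_r -> 'rV[R]_d.+1,
       (forall i, Delta_i i (z i)) /\ y = \sum_(i < r) z i - msig].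
Proof.
apply/seteqP; split=> [_ [m /polarP hm <-]|_ [z [hz ->]]].
  have [|z hz zE] := cayley_decomposition hm.
    by move=> i; rewrite pairC pairDr pair_nv_AT add0r pairC (pair_msig_nv nv_special).
  by exists z; split=> [i|]; [apply: vertices_face|rewrite -zE addrK].
(* The pairings of [z i] with all [nv j] add up to its height 1, and those with [j != i] vanish. *)
have zi i : pair (z i) (nv i) = 1.
  have [[_ <-] h] := hz i; rewrite -sum_nv pair_sumr (bigD1 i) //= big1 ?addr0 //.
have /annihilatorP yE : forall i, pair (\sum_(i < r) z i - msig) (nv i) = 0.
  move=> i; rewrite pairBl (pair_msig_nv nv_special) pair_suml (bigD1 i) //= zi.
  by rewrite big1 ?addr0 ?subrr // => j ji; case: (hz j) => _ ->; rewrite // eq_sym.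
exists ((\sum_(i < r) z i - msig) *m B^T) => //; apply/polarP; rewrite yE subrK.
by apply: big_ind => [||i _]; [exact: cone_of0|exact: cone_ofD|case: (hz i) => -[]].
Qed.

Lemma conv_sums_cone x : conv (seq_sums vertices) x ->
  cone_of S x /\ forall i, pair x (nv i) = 1.
Proof.
move: x; apply: (@conv_min _ _ [set x | cone_of S x /\ forall i, pair x (nv i) = 1]).
  move=> k c p c0 c1 hp.
  split=> [|i].
    apply: big_ind => [||j _]; [exact: cone_of0|exact: cone_ofD|].
    by apply: cone_ofZ => //; case: (hp j).
  rewrite pair_suml -[RHS]c1; apply: eq_bigr => j _.
  by rewrite pairZl; case: (hp j) => _ ->; rewrite mulr1.
move=> v /seq_sumsP[w hw ->].
have hw' i := vertices_face (conv_mem (hw i)).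
split=> [|i].
  by apply: big_ind => [||j _]; [exact: cone_of0|exact: cone_ofD|case: (hw' j) => -[]].
rewrite pair_suml (bigD1 i) //= big1 => [|j ji]; last first.
  by case: (hw' j) => _ ->; rewrite // eq_sym.
by rewrite addr0; have := hw i; rewrite mem_filter => /andP[/eqP].
Qed.

(** Presents the polar by an explicit finite list, on which integrality can be tested. *)
Lemma polar_conv : polar P = conv [seq v *m B^T + - msig *m B^T | v <- seq_sums vertices].
Proof.
rewrite conv_affine; apply/seteqP; split=> [m /polarP hm|_ [x /conv_sums_cone[hx x1] <-]].
  have [|z hz zE] := cayley_decomposition hm.
    by move=> i; rewrite pairC pairDr pair_nv_AT add0r pairC (pair_msig_nv nv_special).
  exists (m *m A^T + msig); first by rewrite zE; apply: conv_seq_sums.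
  by rewrite -mulmxDl addrK pinvAT.
apply/polarP; rewrite -mulmxDl annihilatorP ?subrK // => i.
by rewrite pairBl x1 (pair_msig_nv nv_special) subrr.
Qed.

(** The point [x0] projects to 0 and is interior to [Nabla], since every generator in [S] pairs to
    [1/r] with it. *)
Lemma zero_interior_quotient : zero_interior P.
Proof.
pose g v := (v - r%:R^-1 *: msig) *m B^T.
have ri : 0 < r%:R^-1 :> R by rewrite invr_gt0 lt_def r_neq0 ler0n.
have [v _|v _ /eqP|eps e0 he] := @small_scale R _ S
    (fun v => \sum_(i < e) `|g v ord0 i|) (fun=> r%:R^-1).
- exact: ltW.
- by rewrite gt_eqF.
exists eps; split=> // y hy; pose z := y *m B.
have x0m : pair x0 msig = 1 by rewrite pairZl pairC mn_r mulVf ?r_neq0.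
(* The lift [z] of [y] is brought to height 0 by a multiple of [x0], which [A] kills; [pair y (g v)]
   is then the pairing of this correction with [v]. *)
exists (x0 + (z - pair z msig *: x0)).
  split; last by rewrite pairDl pairBl [pair (_ *: x0) _]pairZl x0m mulr1 subrr addr0.
  apply/(conetP dualST) => v vS.
  have vx0 : pair v x0 = r%:R^-1 by rewrite pairZr (proj2 (Sgen vS)) mulr1.
  have -> : pair v (x0 + (z - pair z msig *: x0)) = r%:R^-1 + pair y (g v).
    rewrite /g -pair_mulmx -/z pairDr pairBr [pair v (_ *: x0)]pairZr vx0 pairBr [pair z (_ *: msig)]pairZr.
    by rewrite [pair v z]pairC [_ * r%:R^-1]mulrC.
  have := he v vS; rewrite ger0_norm ?sumr_ge0 // => h.
  have : `|pair y (g v)| <= r%:R^-1.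
    apply: le_trans h; rewrite mulr_sumr; apply: le_trans (ler_norm_sum _ _ _) _.
    by apply: ler_sum => i _; rewrite normrM ler_wpM2r // ltW.
  by rewrite ler_norml => /andP[h1 _]; rewrite -lerBlDl sub0r.
have x0A : x0 *m A = 0 by rewrite -scalemxAl nsigA scaler0.
by rewrite !(mulmxDl, mulNmx) -[(_ *: x0) *m A]scalemxAl x0A scaler0 subr0 add0r -mulmxA pinvA mulmx1.
Qed.

Lemma affdim_quotient : affdim P (d.+1 - r)%N.
Proof.
rewrite -rank_quotient addKn; exact: affdim_zero_interior zero_interior_quotient.
Qed.

Lemma reflexive_quotient (N' := [set y | exists (n : 'rV[R]_d.+1) (k : int),
    isZvec n /\ y = n + k%:~R *: x0]) :
  reflexive_polytope [set y *m A | y in N'] P.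
Proof.
split; last (split; first exact: zero_interior_quotient).
  exists [seq w *m A + 0 | w <- T]; split.
    move=> _ /mapP[w wT ->]; exists w; last by rewrite addr0.
    by exists w, 0; rewrite scale0r addr0; case: (Tgen wT).
  rewrite conv_affine -(@cone_support_conv _ _ _ msig) => [|w /Tgen[]//].
  by apply/seteqP; split=> _ [y hy <-]; exists y; rewrite ?addr0.
exists [seq v *m B^T + - msig *m B^T | v <- seq_sums vertices]; split; last exact: polar_conv.
move=> _ /mapP[x xs ->] _ [_ [n [k [nZ ->]]] <-].
have [_ x1] := conv_sums_cone (conv_mem xs).
have xn i : pair (x - msig) (nv i) = 0.
  by rewrite pairBl x1 (pair_msig_nv nv_special) subrr.
rewrite -mulmxDl pair_mulmx (annihilatorP xn) pairDl !pairZl.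
(* This removes the fractional part of a point of [N'], a multiple of [nsig]. *)
have -> : pair nsig (x - msig) = 0.
  by rewrite pairC -sum_nv pair_sumr big1.
rewrite !mulr0 addr0; apply: pair_int => //; apply: isZvecB => //.
have [w hw ->] := seq_sumsP xs; apply: isZvec_sum => i _.
by have := hw i; rewrite mem_filter => /andP[_ /Sgen[]].
Qed.

End Projection.

(** * Iterated differences and counting in finite sets *)

Section Differences.

(** Multiplication of the generating series by [1 - t]; the value at 0 amounts to [f (-1) = 0]. *)
Definition backward_diff (f : nat -> int) (j : nat) : int :=
  if j is j'.+1 then f j - f j' else f 0%N.

(** Both sides are the coefficient of [t^i] in [(1 - t)^K] times the series of [f]; the induction is
    Pascal's rule. *)
Lemma binomial_backward_diff K (f : nat -> int) i :
  \sum_(j < i.+1) ((-1) ^+ (i - j) * ('C(K, i - j))%:Z * f j) = iter K backward_diff f i.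
Proof.
elim: K i => [|K IH] i /=.
  rewrite big_ord_recr /= subnn mulr1 mul1r big1 ?add0r // => j _.
  by rewrite bin0n subn_eq0 leqNgt ltn_ord mulr0 mul0r.
case: i => [|i] /=; first by rewrite -IH !big_ord1 !bin0.
rewrite -!IH [in LHS]big_ord_recr [in RHS]big_ord_recr /= !subnn !bin0 addrAC.
congr (_ + _); rewrite -sumrB; apply: eq_bigr => j _.
have ji : (j <= i)%N by rewrite -ltnS.
by rewrite subSn // binS PoszD exprS; ring.
Qed.

End Differences.

Section Counting.
Context {T U : choiceType}.
Implicit Types A B : set T.

Lemma card_disjointU A B : finite_set A -> finite_set B -> (forall x, A x -> ~ B x) ->
  #|` fset_set (A `|` B)| = (#|` fset_set A| + #|` fset_set B|)%N.
Proof.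
move=> fA fB AB; rewrite fset_setU // -cardfsUI -fset_setI //.
suff -> : A `&` B = set0 by rewrite fset_set0 cardfs0 addn0.
by apply/seteqP; split=> // x [/AB].
Qed.

Lemma card_image (f : T -> U) A : finite_set A ->
  (forall x y, A x -> A y -> f x = f y -> x = y) ->
  #|` fset_set [set f x | x in A]| = #|` fset_set A|.
Proof.
move=> fA inj; rewrite fset_set_image // card_in_imfset // => x y.
by rewrite !in_fset_set // !inE; apply: inj.
Qed.

End Counting.

Lemma finite_bounded_Zvec {R : realType} {n} (K : R) :
  finite_set [set y : 'rV[R]_n | isZvec y /\ forall i, `|y ord0 i| <= K].
Proof.
pose m := Num.bound K.
(* Shifting coordinates by [m] enumerates the integral points of the box [[-m, m]^n]. *)
pose g (f : {ffun 'I_n -> 'I_(m + m).+1}) : 'rV[R]_n := \row_i ((f i)%:R - m%:R).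
apply: (@sub_finite_set _ _ (g @` setT)); last exact/finite_image/finite_finset.
move=> y [yZ yK].
have hy i : exists k : 'I_(m + m).+1, y ord0 i = k%:R - m%:R.
  have /intrP[z zE] := yZ i.
  have : `|y ord0 i| < m%:R.
    apply: le_lt_trans (yK i) _; apply: archi_boundP.
    exact: le_trans (normr_ge0 _) (yK i).
  rewrite zE -intr_norm (pmulrn 1 m) ltr_int => zm.
  have zm0 : 0 <= z + m%:Z by move: zm; rewrite ltr_norml => /andP[/ltW]; rewrite lerNl -subr_ge0 opprK addrC.
  have h : (absz (z + m%:Z)%R < (m + m).+1)%N.
    rewrite ltnS -lez_nat gez0_abs // PoszD lerD2r.
    by apply: le_trans (ler_norm _) (ltW zm).
  by exists (Ordinal h); rewrite /= !pmulrn gez0_abs // intrD addrK.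
have [k hk] := choice hy.
exists [ffun i => k i] => //; apply/rowP => i.
by rewrite mxE ffunE hk.
Qed.

(** * Reduced lattice points and the comparison of the two Ehrhart functions *)

Section LatticePoints.
Context {R : realType} {d r e : nat} {S T : seq 'rV[R]_d.+1} {nsig msig : 'rV[R]_d.+1}.
Context {nv : 'I_r -> 'rV[R]_d.+1} {A : 'M[R]_(d.+1, e)}.
Hypothesis Sgen : forall v, v \in S -> isZvec v /\ pair v nsig = 1.
Hypothesis Tgen : forall w, w \in T -> isZvec w /\ pair w msig = 1.
Hypothesis Sfull : fulldim (cone_of S).
Hypothesis Tfull : fulldim (cone_of T).
Hypothesis dualST : dual_cone (cone_of S) = cone_of T.
Hypothesis mn_r : pair msig nsig = r%:R.
Hypothesis msigZ : isZvec msig.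
Hypothesis nv_special : special_simplex (cone_support (cone_of T) msig) nv.
Hypothesis kerA : forall y : 'rV[R]_d.+1, y *m A = 0 <-> in_span nv y.
Hypothesis rkA : \rank A = e.

Let gen_type := generator_type Sgen Tgen Sfull Tfull dualST mn_r nv_special.
Let has_type := simplex_has_type Sgen Tgen Sfull Tfull dualST mn_r nv_special.
Let Nabla := cone_support (cone_of T) msig.
Let x0 := r%:R^-1 *: nsig.
Let P := [set y *m A | y in Nabla].
Let N' := [set y | exists (n : 'rV[R]_d.+1) (k : int), isZvec n /\ y = n + k%:~R *: x0].
Let LP := [set y *m A | y in N'].

(* A lattice point [y] of the dual cone satisfies [reduced i y] exactly when
   [y - nv i] lies outside the cone. *)
Definition reduced i y := exists v, [/\ v \in S, pair v (nv i) = 1 & pair v y = 0].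

(** Interpolates between all lattice points of height [j] in the dual cone, at [s = r], and the
    fully reduced ones, at [s = 0]. *)
Definition level (s j : nat) : set 'rV[R]_d.+1 :=
  [set y | [/\ isZvec y, cone_of T y, pair y msig = j%:R &
               forall i : 'I_r, (s <= i)%N -> reduced i y]].

Definition reduced_upto (j : nat) : set 'rV[R]_d.+1 :=
  [set y | [/\ isZvec y, cone_of T y, pair y msig <= j%:R & forall i, reduced i y]].

Lemma finite_level s j : finite_set (level s j).
Proof.
pose M := j%:R * \sum_(k < size T) \sum_(i < d.+1) `|T`_k ord0 i|.
apply: (sub_finite_set _ (finite_bounded_Zvec M)) => y [yZ [c [c0 yE]] yj _].
(* The coefficients of a point of height [j] add up to [j], so each is at most [j]. *)
split=> // i; have cj : \sum_(k < size T) c k = j%:R.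
  rewrite -yj yE pair_suml; apply: eq_bigr => k _.
  by rewrite pairZl (proj2 (Tgen (mem_nth _ _))) ?mulr1.
rewrite yE summxE; apply: le_trans (ler_norm_sum _ _ _) _.
rewrite /M mulr_sumr; apply: ler_sum => k _.
rewrite mxE normrM ger0_norm //; apply: ler_pM => //.
  by rewrite -cj (bigD1 k) //= lerDl sumr_ge0.
by rewrite (bigD1 i) //= lerDl sumr_ge0.
Qed.

Lemma cone_T_height0 y : cone_of T y -> pair y msig = 0 -> y = 0.
Proof. by apply: cone_of_height0 => w /Tgen[]. Qed.

Lemma reduced0 i : reduced i 0.
Proof. by have [v vS vi] := has_type i; exists v; rewrite pair0r vi eqxx. Qed.

Lemma nvT i : cone_of T (nv i).
Proof. by case: nv_special => /(_ i)[_ []]. Qed.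

Lemma pair_nv_msig i : pair (nv i) msig = 1.
Proof. by case: nv_special => /(_ i)[_ []]. Qed.

Lemma level_zero s s' : level s 0 = level s' 0.
Proof.
by apply/seteqP; split=> y [yZ yT y0 _]; split=> // i _;
   rewrite (cone_T_height0 yT y0); exact: reduced0.
Qed.

(** A point is either reduced in direction [i], or [nv i] can be subtracted from it. Generators of
    type [k != i] vanish on [nv i], so reducedness in the directions above [i] is unaffected. *)
Lemma level_succ (i : 'I_r) j :
  level i.+1 j.+1 = level i j.+1 `|` [set y + nv i | y in level i.+1 j].
Proof.
apply/seteqP; split=> [y [yZ yT yj yr]|y].
  have [ri|ri] := pselect (reduced i y); [left|right].
    split=> // k; rewrite leq_eqVlt => /predU1P[/val_inj <-//|]; exact: yr.
  have y1 v : v \in S -> pair v (nv i) = 1 -> 1 <= pair v y.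
    move=> vS vi; apply: int_gt0_ge1; first by apply: pair_int => //; case: (Sgen vS).
    rewrite lt_def (proj1 (conetP dualST _) yT _ vS) andbT; apply/eqP => v0.
    by apply: ri; exists v.
  exists (y - nv i); last by rewrite subrK.
  split.
  - by apply: isZvecB => //; exact: nvZ nv_special _.
  - apply/(conetP dualST) => v vS; rewrite pairBr subr_ge0.
    have [k hk] := gen_type vS; rewrite hk; case: eqP => [ik|_].
      by apply: y1; rewrite // hk ik eqxx.
    exact: (proj1 (conetP dualST _) yT).
  - by rewrite pairBl yj pair_nv_msig -natr1 addrK.
  - move=> k ik; have [v [vS vk vy]] := yr k ik; exists v; split=> //.
    have [l hl] := gen_type vS; move: vk; rewrite pairBr vy !hl.
    case: (k =P l) => [<- _|_ /eqP]; last by rewrite eq_sym oner_eq0.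
    by rewrite -val_eqE ltn_eqF // subr0.
move=> [[yZ yT yj yr]|[{}y [yZ yT yj yr] <-]].
  by split=> // k ik; apply: yr; apply: ltnW.
split.
- by apply: isZvecD => //; exact: nvZ nv_special _.
- by apply: cone_ofD => //; exact: nvT.
- by rewrite pairDl yj pair_nv_msig natr1.
- move=> k ik; have [v [vS vk vy]] := yr k ik; exists v; split=> //.
  have [l hl] := gen_type vS; move: vk; rewrite pairDr vy !hl.
  case: (k =P l) => [<- _|_ /eqP]; last by rewrite eq_sym oner_eq0.
  by rewrite -val_eqE ltn_eqF // addr0.
Qed.

Definition level_count s j : int := (#|` fset_set (level s j)|)%:Z.

Lemma level_count_diff s : (s < r)%N ->
  backward_diff (level_count s.+1) = level_count s.
Proof.
move=> sr; apply/funext => -[|j] /=; first by rewrite /level_count (level_zero s.+1 s).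
have -> : level_count s.+1 j.+1 = level_count s j.+1 + level_count s.+1 j.
  have := level_succ (Ordinal sr) j; rewrite /= /level_count => ->.
  rewrite card_disjointU ?PoszD.
  - by rewrite card_image // => [|x y _ _ /addIr//]; exact: finite_level.
  - exact: finite_level.
  - exact/finite_image/finite_level.
  (* The union is disjoint: a generator of type [s] is at least 1 on [y + nv s], which is therefore
     not reduced. *)
  move=> _ /[swap] [[y [_ yT _ _] <-]] [_ _ _ /(_ (Ordinal sr) (leqnn _))[v [vS v1]]].
  rewrite pairDr v1 => h; have := proj1 (conetP dualST _) yT _ vS.
  by rewrite -(lerD2r 1) h add0r ler10.
by rewrite addrK.
Qed.

Lemma iter_level_count : iter r backward_diff (level_count r) = level_count 0.
Proof.
suff h s : (s <= r)%N -> iter s backward_diff (level_count s) = level_count 0 by apply: h.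
by elim: s => // s IH sr; rewrite iterSr level_count_diff // IH // ltnW.
Qed.

Lemma Nabla_dilate j q : (exists p, Nabla p /\ q = j%:R *: p) <->
  cone_of T q /\ pair q msig = j%:R.
Proof.
split=> [[p [[pT p1] ->]]|[qT qj]].
  by split; [exact: cone_ofZ|rewrite pairZl p1 mulr1].
have [j0|j0] := posnP j.
  (* For [j = 0] some point of [Nabla] is required; a simplex vertex serves. *)
  rewrite j0 in qj *; pose i := Ordinal (index_gt0 Sgen Tgen Tfull dualST mn_r).
  exists (nv i); rewrite scale0r (cone_T_height0 qT qj).
  by split=> //; split; [exact: nvT|exact: pair_nv_msig].
have jn : j%:R != 0 :> R by rewrite pnatr_eq0 -lt0n.
exists (j%:R^-1 *: q); split; last by rewrite scalerA divff // scale1r.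
by split; [apply: cone_ofZ; rewrite // invr_ge0|rewrite pairZl qj mulVf].
Qed.

Lemma lattice_count_Nabla j :
  (lattice_count (@isZvec R d.+1) Nabla j)%:Z = level_count r j.
Proof.
congr (#|` fset_set _|)%:Z; apply/seteqP; split=> [y [yZ /Nabla_dilate[yT yj]]|y [yZ yT yj _]].
  by split=> // i; rewrite leqNgt ltn_ord.
by split=> //; apply/Nabla_dilate.
Qed.

Lemma reduced_upto0 : reduced_upto 0 = level 0 0.
Proof.
apply/seteqP; split=> y [yZ yT yj yr]; split=> //.
- apply/eqP; rewrite eq_le yj.
  by apply: cone_of_ge0 yT => w /Tgen[_ ->]; exact: ler01.
- by rewrite yj.
- by move=> i; apply: yr.
Qed.

Lemma reduced_uptoS j : reduced_upto j.+1 = reduced_upto j `|` level 0 j.+1.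
Proof.
apply/seteqP; split=> [y [yZ yT yj yr]|y [[yZ yT yj yr]|[yZ yT yj yr]]].
- have [h|h] := leP (pair y msig) j%:R; [by left|right; split=> //].
  apply/eqP; rewrite eq_le yj /= -natr1 addrC -lerBrDr; apply: int_gt0_ge1.
    by apply: rpredB; [exact: pair_int|exact: natr_int].
  by rewrite subr_gt0.
- by split=> //; apply: le_trans yj _; rewrite ler_nat.
- by split=> //; [rewrite yj|move=> i; apply: yr].
Qed.

Lemma finite_reduced_upto j : finite_set (reduced_upto j).
Proof.
elim: j => [|j IH]; first by rewrite reduced_upto0; exact: finite_level.
by rewrite reduced_uptoS finite_setU; split=> //; exact: finite_level.
Qed.

(** The generator witnessing reducedness reads off the coefficient of [nv i] in any shift along the
    simplex. *)
Lemma reduced_shift y c i : reduced i y ->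
  exists2 v, v \in S & pair v (y + \sum_(j < r) c j *: nv j) = c i.
Proof.
move=> [v [vS vi vy]]; exists v => //; have [l hl] := gen_type vS.
have il : i = l by apply/eqP; move: vi; rewrite hl; case: eqP => // _ /eqP; rewrite eq_sym oner_eq0.
rewrite pairDr vy add0r pair_sumr (bigD1 i) //= pairZr vi mulr1 big1 ?addr0 // => j ji.
by rewrite pairZr hl -il (negbTE ji) mulr0.
Qed.

Lemma eq_mulmx_in_span y z : y *m A = z *m A -> exists c, y = z + \sum_(i < r) c i *: nv i.
Proof.
move=> yz; have /kerA[c hc] : (y - z) *m A = 0 by rewrite mulmxBl yz subrr.
by exists c; rewrite -hc addrC subrK.
Qed.

(** The difference is a combination of the [nv i]; by [reduced_shift] both [c i] and [- c i] are
    pairings of a generator with a point of the dual cone, hence nonnegative. *)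
Lemma reduced_inj y z : cone_of T y -> cone_of T z ->
  (forall i, reduced i y) -> (forall i, reduced i z) -> y *m A = z *m A -> y = z.
Proof.
move=> yT zT yr zr /eq_mulmx_in_span[c yE].
have zE : z = y + \sum_(i < r) - c i *: nv i.
  rewrite yE -addrA -big_split /= big1 ?addr0 // => i _.
  by rewrite scaleNr subrr.
rewrite yE big1 ?addr0 // => i _; suff -> : c i = 0 by rewrite scale0r.
apply/eqP; rewrite eq_le; apply/andP; split.
  have [v vS] := reduced_shift (fun i => - c i) (yr i); rewrite -zE => h.
  by rewrite -oppr_ge0 -h; apply: (proj1 (conetP dualST _) zT).
have [v vS] := reduced_shift c (zr i); rewrite -yE => <-.
exact: (proj1 (conetP dualST _) yT).
Qed.

Lemma reduced_representative n : isZvec n ->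
  exists z, [/\ isZvec z, cone_of T z, forall i, reduced i z & z *m A = n *m A].
Proof.
move=> nZ.
have hmin i : exists v, [/\ v \in S, pair v (nv i) = 1 &
    forall w, w \in S -> pair w (nv i) = 1 -> pair v n <= pair w n].
  have [v vS hv] := has_type i; have vi : pair v (nv i) = 1 by rewrite hv eqxx.
  have h : (index v S < size S)%N by rewrite index_mem.
  pose Q (k : 'I_(size S)) := pair S`_k (nv i) == 1.
  have Q0 : Q (Ordinal h) by rewrite /Q /= nth_index // vi.
  case: (Order.TotalTheory.arg_minP (fun k : 'I_(size S) => pair S`_k n) Q0) => k /eqP hk mk.
  exists S`_k; split=> // [|w wS wi]; first exact: mem_nth.
  have h' : (index w S < size S)%N by rewrite index_mem.
  by have := mk (Ordinal h'); rewrite /Q /= nth_index // wi eqxx => /(_ isT).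
have [v hv] := choice hmin.
(* Subtracting the minimum over the generators of type [i] makes their smallest pairing exactly 0,
   which gives membership in the dual cone and reducedness together. *)
exists (n - \sum_(i < r) pair (v i) n *: nv i).
have pE w i : w \in S -> pair w (nv i) = 1 ->
    pair w (n - \sum_(j < r) pair (v j) n *: nv j) = pair w n - pair (v i) n.
  move=> wS wi; have [l hl] := gen_type wS.
  have il : i = l by apply/eqP; move: wi; rewrite hl; case: eqP => // _ /eqP; rewrite eq_sym oner_eq0.
  rewrite pairBr pair_sumr (bigD1 i) //= pairZr wi mulr1 big1 ?addr0 // => j ji.
  by rewrite pairZr hl -il (negbTE ji) mulr0.
split.
- apply: isZvecB => //; apply: isZvec_sum => i _; apply: isZvecZ; last exact: nvZ nv_special _.
  by apply: pair_int => //; have [/Sgen[]] := hv i.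
- apply/(conetP dualST) => w wS; have [l hl] := gen_type wS.
  have wl : pair w (nv l) = 1 by rewrite hl eqxx.
  by rewrite (pE _ _ wS wl) subr_ge0; have [_ _] := hv l; apply.
- by move=> i; have [vS vi _] := hv i; exists (v i); split=> //; rewrite (pE _ _ vS vi) subrr.
- rewrite mulmxBl mulmx_suml big1 ?subr0 // => i _.
  by rewrite -scalemxAl (nvA kerA) scaler0.
Qed.

Lemma lattice_points_quotient j :
  [set y | LP y /\ exists q, P q /\ y = j%:R *: q] = [set y *m A | y in reduced_upto j].
Proof.
apply/seteqP; split=> [_ [[_ [n [k [nZ ->]]] <-] [_ [[p Np <-] e']]]|_ [y [yZ yT yj yr] <-]].
  (* The refined lattice [N'] and the integral vectors have the same projection. *)
  have x0A : (n + k%:~R *: x0) *m A = n *m A.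
    by rewrite mulmxDl -!scalemxAl (nsigA Sgen Tgen Sfull Tfull dualST mn_r nv_special kerA) !scaler0 addr0.
  rewrite x0A; have [z [zZ zT zr zn]] := reduced_representative nZ.
  exists z => //; split=> //.
  have /eq_mulmx_in_span[c pE] : (j%:R *: p) *m A = z *m A by rewrite -scalemxAl zn -x0A.
  have [qT qj] : cone_of T (j%:R *: p) /\ pair (j%:R *: p) msig = j%:R.
    by apply/Nabla_dilate; exists p.
  (* The point [j p] differs from the reduced [z] by nonnegative multiples of the [nv i], so the
     height of [z] is at most [j]. *)
  rewrite -qj pE pairDl lerDl pair_suml; apply: sumr_ge0 => i _.
  rewrite pairZl pair_nv_msig mulr1; have [v vS] := reduced_shift c (zr i).
  by rewrite -pE => <-; apply: (proj1 (conetP dualST _) qT).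
split; first by exists y => //; exists y, 0; rewrite scale0r addr0.
pose i := Ordinal (index_gt0 Sgen Tgen Tfull dualST mn_r).
(* A multiple of a single vertex raises [y] to height [j] without changing its projection. *)
have [|q [Nq qE]] := proj2 (Nabla_dilate j (y + (j%:R - pair y msig) *: nv i)).
  split; last by rewrite pairDl pairZl pair_nv_msig mulr1 addrC subrK.
  by apply: cone_ofD => //; apply: cone_ofZ; [rewrite subr_ge0|exact: nvT].
exists (q *m A); split; first by exists q.
by rewrite scalemxAl -qE mulmxDl -scalemxAl (nvA kerA) scaler0 addr0.
Qed.

Lemma lattice_count_quotient j : lattice_count LP P j = #|` fset_set (reduced_upto j)|.
Proof.
rewrite /lattice_count lattice_points_quotient card_image //.
  exact: finite_reduced_upto.
by move=> y z [_ yT _ yr] [_ zT _ zr]; apply: reduced_inj.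
Qed.

Lemma lattice_count_quotient_diff :
  backward_diff (fun j => (lattice_count LP P j)%:Z) = level_count 0.
Proof.
apply/funext => -[|j] /=; rewrite !lattice_count_quotient ?reduced_upto0 //.
rewrite reduced_uptoS card_disjointU.
- by rewrite PoszD addrC addKr.
- exact: finite_reduced_upto.
- exact: finite_level.
by move=> y [_ _ h _] [_ _ yj _]; move: h; rewrite yj ler_nat ltnn.
Qed.

Lemma hstar_quotient i :
  hstar_coef LP P (d.+1 - r)%N i = hstar_coef (@isZvec R d.+1) Nabla d i.
Proof.
rewrite /hstar_coef !(binomial_backward_diff _ (fun j => (lattice_count _ _ j)%:Z)).
have -> : (fun j => (lattice_count (@isZvec R d.+1) Nabla j)%:Z) = level_count r.
  by apply/funext => j; rewrite lattice_count_Nabla.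
(* Of the [d + 1] differences on the [Nabla] side, [r] lead to the count of reduced points, as one
   does on the side of [P]; [d + 1 - r] remain on both. *)
rewrite iterSr lattice_count_quotient_diff -iter_level_count -iterD subnK //.
by rewrite -(rank_quotient nv_special kerA rkA) leq_addr.
Qed.

End LatticePoints.

Theorem theorem2p17 (R : realType) (d r e : nat)
  (sigma : set 'rV[R]_d.+1) (nsig msig : 'rV[R]_d.+1)
  (nv : 'I_r -> 'rV[R]_d.+1) (A : 'M[R]_(d.+1, e)) :
  gorenstein sigma nsig ->
  gorenstein (dual_cone sigma) msig ->
  pair msig nsig = r%:R ->
  special_simplex (cone_support (dual_cone sigma) msig) nv ->
  (forall y : 'rV[R]_d.+1, y *m A = 0 <-> in_span nv y) ->
  \rank A = e ->
  let Delta := cone_support sigma nsig in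
  let Nabla := cone_support (dual_cone sigma) msig in
  let Delta_i := fun i : 'I_r =>
    [set x | Delta x /\ forall j : 'I_r, j != i -> pair x (nv j) = 0] in
  let x := r%:R^-1 *: nsig in
  let N' := [set y | exists (n : 'rV[R]_d.+1) (k : int), isZvec n /\ y = n + k%:~R *: x] in
  let P := [set y *m A | y in Nabla] in
  let LP := [set y *m A | y in N'] in
  affdim P (d.+1 - r)%N /\
  reflexive_polytope LP P /\
  (forall i, hstar_coef LP P (d.+1 - r)%N i = hstar_coef (@isZvec R d.+1) Nabla d i) /\
  [set m *m A^T | m in polar P] =
    [set y | exists z : 'I_r -> 'rV[R]_d.+1,
       (forall i, Delta_i i (z i)) /\ y = \sum_(i < r) z i - msig].
Proof.
move=> [Sfull [_ [S [Sgen sE]]]] [Tfull [msigZ [T [Tgen dualE]]]] mn nv_special kerA rkA.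
rewrite dualE in nv_special Tfull *.
rewrite sE in Sfull dualE *.
split; first exact: affdim_quotient Sgen Tgen Sfull Tfull dualE mn nv_special kerA rkA.
split; first exact: reflexive_quotient Sgen Tgen Sfull Tfull dualE mn msigZ nv_special kerA rkA.
split; last exact: polar_minkowski.
exact: hstar_quotient Sgen Tgen Sfull Tfull dualE mn msigZ nv_special kerA rkA.
Qed.
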